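(* Let $(\alpha,\beta)$ be a rigid variable elliptic structure on an open set $\Omega\subset\mathbb{R}^2$ with spectral parameter $\lambda$, and let $A,B,F$ be $A_z$-valued sections on $\Omega$ (the coefficients). Put $\xi(x,y)=y-\lambda(x,y)\,x$ and $\Phi=\bar\xi_x+\lambda\,\bar\xi_y$. Let $\Omega'\subseteq\Omega$ be a connected open subset on which $\Phi\neq 0$, and let $W$ be a $C^1$ section on $\Omega'$ satisfying the Vekua equation $$\partial_{\bar z}W+A\,W+B\,\widehat W=F .$$ Then the transport image $f=W_\lambda$ satisfies on $\Omega'$ the standard Vekua equation in the coordinate $\xi$, $$f_{\bar\xi}+A'f+B'\bar f=F',\qquad A'=\frac{2A_\lambda}{\Phi},\quad B'=\frac{2B_\lambda}{\Phi},\quad F'=\frac{2F_\lambda}{\Phi},$$ where $f_{\bar\xi}$ is the standard $\bar\partial$-derivative in the (local) complex coordinate $\xi$ and $\bar f$ is ordinary complex conjugation. If, in addition, $\xi$ is injective on $\Omega'$, then this is a global standard Vekua equation on the planar domain $\xi(\Omega')\subset\mathbb{C}$; that is, $\tilde f=f\circ\xi^{-1}$ satisfies $\partial_{\bar\xi}\tilde f+(A'\circ\xi^{-1})\tilde f+(B'\circ\xi^{-1})\overline{\tilde f}=F'\circ\xi^{-1}$ on $\xi(\Omega')$.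
   Context: A variable elliptic structure on an open set $\Omega\subset\mathbb{R}^2$ (coordinates $(x,y)$, points denoted $z=(x,y)$) is a pair $\alpha,\beta\in C^1(\Omega,\mathbb{R})$ with $\Delta:=4\alpha-\beta^2>0$ on $\Omega$. The fiber algebra at $z$ is $A_z=\mathbb{R}[X]/(X^2+\beta(z)X+\alpha(z))$, generated by $1$ and the class $i=i(z)$ of $X$ (the moving generator), so $i^2+\beta i+\alpha=0$. A section is $W=U+Vi$ with $U,V$ real-valued functions, and it is $C^1$ if $U,V$ are. The derivatives $i_x,i_y$ of the generator are the $A_z$-valued sections obtained by differentiating the structure relation: $(2i+\beta)i_x=-\alpha_x-\beta_x i$ and $(2i+\beta)i_y=-\alpha_y-\beta_y i$ (here $2i+\beta$ is invertible since $(2i+\beta)^2=-\Delta$). Set $W_x=U_x+V_x i+V i_x$, $W_y=U_y+V_y i+V i_y$, and $\partial_{\bar z}W=\tfrac12(W_x+i\,W_y)$. The obstruction is $G=i_x+i\,i_y$; the structure is rigid if $G=0$ on $\Omega$. Conjugation is $\widehat{U+Vi}=U+V(-\beta-i)$. The imaginary unit of $\mathbb{C}$ is written $\mathrm{i}$. The spectral parameter is $\lambda=\frac{-\beta+\mathrm{i}\sqrt{\Delta}}{2}:\Omega\to\mathbb{C}$, so $\operatorname{Im}\lambda>0$. The transport map sends a section $W=U+Vi$ to the $\mathbb{C}$-valued function $W_\lambda=U+V\lambda$. Writing $\xi=p+\mathrm{i}q$ with $p,q$ real, at points where $\Phi\ne0$ the map $(x,y)\mapsto(p,q)$ is a local $C^1$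 diffeomorphism, and $f_{\bar\xi}$ denotes $\tfrac12(\partial_p+\mathrm{i}\,\partial_q)$ applied to $f$ expressed locally in the coordinates $(p,q)$. *)

(* Defs.v *)
From HB Require Import structures.
From mathcomp Require Import all_boot all_order all_algebra.
From mathcomp Require Import qpoly complex.
From mathcomp Require Import all_classical all_reals all_analysis.

Set Implicit Arguments.
Unset Strict Implicit.
Unset Printing Implicit Defensive.

Import Order.TTheory GRing.Theory Num.Theory.
Import numFieldNormedType.Exports.

Local Open Scope classical_set_scope.
Local Open Scope ring_scope.
Local Open Scope complex_scope.

Section Plane.
Context {R : realType}.
Implicit Types (D U : set (R * R)) (z w : R * R).

Definition dx (f : R * R -> R) z : R := 'D_((1, 0) : R * R) f z.
Definition dy (f : R * R -> R) z : R := 'D_((0, 1) : R * R) f z.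

(* Meant for open D: the partial derivatives are taken in the ambient plane. *)
Definition C1_on D (f : R * R -> R) : Prop :=
  forall z, D z ->
    [/\ derivable f z ((1, 0) : R * R), derivable f z ((0, 1) : R * R),
        {for z, continuous (dx f)} & {for z, continuous (dy f)}].

(* R[i] carries no R-normed structure in the library, so complex-valued
   functions are differentiated through their real and imaginary parts. *)
Definition dxC (f : R * R -> R[i]) z : R[i] :=
  dx (fun w => complex.Re (f w)) z +i* dx (fun w => complex.Im (f w)) z.
Definition dyC (f : R * R -> R[i]) z : R[i] :=
  dy (fun w => complex.Re (f w)) z +i* dy (fun w => complex.Im (f w)) z.

Definition C1C_on D (f : R * R -> R[i]) : Prop :=
  C1_on D (fun z => complex.Re (f z)) /\ C1_on D (fun z => complex.Im (f z)).

Definition has_partialsC (f : R * R -> R[i]) z : Prop :=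
  [/\ derivable (fun w => complex.Re (f w)) z ((1, 0) : R * R),
      derivable (fun w => complex.Re (f w)) z ((0, 1) : R * R),
      derivable (fun w => complex.Im (f w)) z ((1, 0) : R * R) &
      derivable (fun w => complex.Im (f w)) z ((0, 1) : R * R)].

Definition dbar (f : R * R -> R[i]) w : R[i] := (dxC f w + 'i%C * dyC f w) / 2.

(* C is identified with the plane R * R of pairs (p, q). *)
Definition pq (xi : R * R -> R[i]) z : R * R :=
  (complex.Re (xi z), complex.Im (xi z)).

Definition C1_diffeo U (phi g : R * R -> R * R) : Prop :=
  [/\ open U /\ open (phi @` U),
      C1_on U (fun z => (phi z).1) /\ C1_on U (fun z => (phi z).2),
      forall z, U z -> g (phi z) = z &
      C1_on (phi @` U) (fun w => (g w).1) /\
      C1_on (phi @` U) (fun w => (g w).2)].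

(* f_{\bar xi}(z) = v: the map (x, y) |-> (p, q) has a local C^1 inverse at z
   and, for every such inverse g, v is the dbar-derivative of f \o g at xi z. *)
Definition is_dbar_coord (xi f : R * R -> R[i]) z (v : R[i]) : Prop :=
  (exists U g, U z /\ C1_diffeo U (pq xi) g) /\
  (forall U g, U z -> C1_diffeo U (pq xi) g ->
     has_partialsC (f \o g) (pq xi z) /\ dbar (f \o g) (pq xi z) = v).

Definition vekua_coord (xi : R * R -> R[i]) D (a b c f : R * R -> R[i]) :=
  forall z, D z ->
    exists2 v, is_dbar_coord xi f z v & v + a z * f z + b z * (f z)^* = c z.

Definition vekua_on D (a b c f : R * R -> R[i]) : Prop :=
  C1C_on D f /\
  forall w, D w -> dbar f w + a w * f w + b w * (f w)^* = c w.

End Plane.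

Section EllipticStructure.
Context {R : realType}.
Variables al be : R * R -> R.
Implicit Types (D : set (R * R)) (z : R * R).

Definition discr z : R := 4 * al z - be z ^+ 2.

Definition elliptic_structure D : Prop :=
  [/\ C1_on D al, C1_on D be & forall z, D z -> 0 < discr z].

Definition struct_poly z : {poly R} := 'X^2 + be z *: 'X + (al z)%:P.

Definition fiber z := {poly %/ struct_poly z}.

Definition section := forall z, fiber z.

Definition gen : section := fun z => 'qX.

(* W = U + V i: elements of {poly %/ p} are represented by their remainder
   mod p, of degree < 2 here, so U and V are its coefficients. *)
Definition coU (W : section) z : R := (W z : {poly R})`_0.
Definition coV (W : section) z : R := (W z : {poly R})`_1.

Definition C1_section D (W : section) : Prop :=
  C1_on D (coU W) /\ C1_on D (coV W).

(* 2 i + beta is a unit of the fiber wherever discr > 0, since its square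
   is - discr. *)
Definition gen_x : section := fun z =>
  (- (dx al z)%:A - dx be z *: gen z) / (2 * gen z + (be z)%:A).
Definition gen_y : section := fun z =>
  (- (dy al z)%:A - dy be z *: gen z) / (2 * gen z + (be z)%:A).

Definition sec_x (W : section) : section := fun z =>
  (dx (coU W) z)%:A + dx (coV W) z *: gen z + coV W z *: gen_x z.
Definition sec_y (W : section) : section := fun z =>
  (dy (coU W) z)%:A + dy (coV W) z *: gen z + coV W z *: gen_y z.

Definition dzbar (W : section) : section := fun z =>
  2^-1 *: (sec_x W z + gen z * sec_y W z).

Definition obstruction : section := fun z => gen_x z + gen z * gen_y z.

Definition rigid D : Prop := forall z, D z -> obstruction z = 0.

Definition sec_conj (W : section) : section := fun z =>
  (coU W z)%:A + coV W z *: (- (be z)%:A - gen z).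

Definition lam z : R[i] := (- (be z)%:C + 'i%C * (Num.sqrt (discr z))%:C) / 2.

Definition transport (W : section) z : R[i] :=
  (coU W z)%:C + (coV W z)%:C * lam z.

Definition xi z : R[i] := (z.2)%:C - lam z * (z.1)%:C.

Definition Phi z : R[i] :=
  dxC (fun w => (xi w)^*) z + lam z * dyC (fun w => (xi w)^*) z.

End EllipticStructure.

(* Main.v *)
Require Import Defs.
From HB Require Import structures.
From mathcomp Require Import all_boot all_order all_algebra.
From mathcomp Require Import qpoly complex.
From mathcomp Require Import all_classical all_reals all_analysis.
From mathcomp Require Import ring lra.

Set Implicit Arguments.
Unset Strict Implicit.
Unset Printing Implicit Defensive.

Import Order.TTheory GRing.Theory Num.Theory.
Import numFieldNormedType.Exports.

Local Open Scope classical_set_scope.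
Local Open Scope ring_scope.
Local Open Scope complex_scope.

(* A rigid structure satisfies lambda_x + lambda lambda_y = 0, because
   evaluation of the moving generator at lambda is a ring morphism from each
   fiber to C, sending i_x and i_y to lambda_x and lambda_y.  The same morphism
   turns the Vekua equation into f_x + lambda f_y + 2 A_lambda f
   + 2 B_lambda conj(f) = 2 F_lambda.  Rigidity also gives
   xi_x + lambda xi_y = 0, so in the coordinate xi the operator
   d_x + lambda d_y equals Phi d/d(conj xi).  Writing b = Im lambda,
   Phi = 2 b (q_y + i p_y) while the Jacobian of (p, q) is b (p_y^2 + q_y^2),
   so Phi != 0 is exactly what the inverse function theorem requires. *)

(** * C^1 functions on the plane *)

(** The obstacle is the inverse map. The global conclusion concerns every left inverse [g] of
    [pq xi] on the image, with no regularity assumed of it, and the local one concerns every local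
    inverse. The inverse function theorem is therefore proved in this form: any left inverse of a
    C^1 map with nonvanishing Jacobian on an open set is itself C^1, and its partials are the
    entries of the inverse matrix. One computation then serves both conclusions. The analytic input
    is strict differentiability, an estimate in two moving points: it makes the Newton map with
    derivative frozen at the base point a contraction, and injectivity, surjectivity and the
    differential of the inverse are all read off from that. On the complex side, the factor Phi
    comes from the chain rule f_x + lambda f_y = f_xi (xi_x + lambda xi_y) + f_{conj xi} Phi, whose
    first bracket vanishes. Complex identities are checked on real and imaginary parts, since that
    is how the derivatives are defined. *)

Lemma differentiable_approx (R : realType) (V W : normedModType R)
    (f : V -> W) (L : {linear V -> W}) (x : V) :
  continuous L ->
  (forall e, 0 < e ->
     \forall y \near x, `|f y - f x - L (y - x)| <= e * `|y - x|) ->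
  differentiable f x /\ 'd f x = L :> (V -> W).
Proof.
move=> cL fL.
have fE : f \o shift x = cst (f x) + L +o_ 0 id.
  apply/eqaddoP => e e0; have := fL e e0.
  rewrite (near_shift 0) subr0; apply: filterS => y /=.
  by rewrite addrK opprD addrA.
have dL := diff_unique cL fE.
by split=> //; apply/diff_locallyP; rewrite dL.
Qed.

Section PlaneCalculus.
Context {R : realType}.
Implicit Types (D E U : set (R * R)) (f : R * R -> R) (z w : R * R).

(** The plane carries the maximum norm, so balls are squares. This is what keeps axis-parallel paths
    between two points of a ball inside that ball. *)
Lemma norm_prod_le z (e : R) : (`|z| <= e) = (`|z.1| <= e) && (`|z.2| <= e).
Proof. by rewrite prod_normE ge_max. Qed.

Definition linform (a b : R) z : R := a * z.1 + b * z.2.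

Lemma linform_linear a b : linear (linform a b).
Proof.
move=> k u v; rewrite /linform /= /GRing.scale/= /GRing.scale/=; ring.
Qed.

HB.instance Definition _ a b :=
  GRing.isLinear.Build R (R * R)%type R _ (linform a b) (linform_linear a b).

Lemma linform_bound a b z : `|linform a b z| <= (`|a| + `|b|) * `|z|.
Proof.
rewrite /linform (le_trans (ler_normD _ _))// !normrM mulrDl.
by rewrite lerD// ler_wpM2l// prod_normE le_max lexx ?orbT.
Qed.

Lemma linform_continuous a b : continuous (linform a b).
Proof.
move=> z; apply: cvgD; apply: cvgM; [exact: cvg_cst|exact: cvg_fst|
  exact: cvg_cst|exact: cvg_snd].
Qed.

Lemma near_box D z : open D -> D z ->
  exists2 d : R, 0 < d & forall w, `|w - z| < d -> D w.
Proof.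
move=> oD Dz; have /nbhs_normP[d /= d0 dD] : nbhs z D by exact: open_nbhs_nbhs.
by exists d => // w wz; apply: dD; rewrite /ball_ /= distrC.
Qed.

Lemma near_norm (P : set (R * R)) z : (\forall w \near z, P w) ->
  exists2 d : R, 0 < d & forall w, `|w - z| < d -> P w.
Proof.
move=> /nbhs_normP[d /= d0 dD].
by exists d => // w wz; apply: dD; rewrite /ball_ /= distrC.
Qed.

Lemma near_dist_lt z (d : R) : 0 < d -> \forall w \near z, `|w - z| < d.
Proof.
by move=> d0; apply/nbhs_normP; exists d => //= w; rewrite /ball_/= distrC.
Qed.

Lemma slice_x f z : derivable f z (1, 0) ->
  is_derive z.1 1 (fun t : R => f (t, z.2)) (dx f z).
Proof.
move=> df.
have E : (fun h : R => h^-1 *: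
    (((fun t : R => f (t, z.2)) \o shift z.1) (h *: (1 : R)) - f (z.1, z.2)))
   = (fun h : R => h^-1 *: ((f \o shift z) (h *: ((1, 0) : R * R)) - f z)).
  apply/funext => h /=; rewrite -surjective_pairing; congr (_ *: (f _ - _)).
  by apply/pair_equal_spec; split; rewrite //= /GRing.scale/= mulr0 add0r.
by split; rewrite /derivable/derive E.
Qed.

Lemma slice_y f z : derivable f z (0, 1) ->
  is_derive z.2 1 (fun t : R => f (z.1, t)) (dy f z).
Proof.
move=> df.
have E : (fun h : R => h^-1 *:
    (((fun t : R => f (z.1, t)) \o shift z.2) (h *: (1 : R)) - f (z.1, z.2)))
   = (fun h : R => h^-1 *: ((f \o shift z) (h *: ((0, 1) : R * R)) - f z)).
  apply/funext => h /=; rewrite -surjective_pairing; congr (_ *: (f _ - _)).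
  by apply/pair_equal_spec; split; rewrite //= /GRing.scale/= mulr0 add0r.
by split; rewrite /derivable/derive E.
Qed.

(** Mean value theorem for g(t) - m t. The hypotheses are centred at [c] because [a] and [b] are two
    arbitrary points near it; exchanging them only changes a sign inside the norm. *)
Lemma derive_approx (g dg : R -> R) (a b c k m e : R) :
  (forall t, `|t - c| <= k -> is_derive t 1 g (dg t)) ->
  (forall t, `|t - c| <= k -> `|dg t - m| <= e) ->
  `|a - c| <= k -> `|b - c| <= k ->
  `|g b - g a - m * (b - a)| <= e * `|b - a|.
Proof.
move=> gd dge; wlog ab : a b / a <= b => [wl ak bk|ak bk].
  have [ab|/ltW ba] := leP a b; first exact: wl.
  rewrite [X in _ <= e * X]distrC.
  have -> : g b - g a - m * (b - a) = - (g a - g b - m * (a - b)) by ring.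
  by rewrite normrN; exact: wl.
have near_c t : t \in `[a, b] -> `|t - c| <= k.
  rewrite in_itv/= => /andP[at1 tb]; move: ak bk; rewrite !ler_norml.
  by move=> /andP[? ?] /andP[? ?]; apply/andP; split; lra.
have [||d dab ->] := @MVT_segment _ g dg a b ab.
- by move=> x /subset_itv_oo_cc/near_c; exact: gd.
- by apply: derivable_within_continuous => x /near_c /gd[].
by rewrite -mulrBl normrM ler_wpM2r// dge// near_c.
Qed.

(** Strict differentiability at [z]: both endpoints move, while the linear part stays frozen at [z].
    The path from [a] to [b] goes through the corner (a.1, b.2), and each of its two legs costs e /
    2. *)
Lemma C1_strict D f z e : open D -> C1_on D f -> D z -> 0 < e ->
  exists2 d : R, 0 < d & forall a b, `|a - z| < d -> `|b - z| < d ->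
    `|f b - f a - linform (dx f z) (dy f z) (b - a)| <= e * `|b - a|.
Proof.
move=> oD fD Dz e0; have e20 : 0 < e / 2 by rewrite divr_gt0.
have [_ _ cx cy] := fD z Dz.
have : \forall w \near z, [/\ D w, `|dx f w - dx f z| <= e / 2 &
    `|dy f w - dy f z| <= e / 2].
  have /cvgrPdistC_le/(_ _ e20) nx := cx.
  have /cvgrPdistC_le/(_ _ e20) ny := cy.
  have nD : \forall w \near z, D w by exact: open_nbhs_nbhs.
  exact: filterS3 (fun w Dw hx hy => And3 Dw hx hy) nD nx ny.
move=> /near_norm[d d0 dP]; exists d => // a b az bz.
(* The closed square of radius [k] about [z] contains [a], [b], the corner and both legs, and
   [k < d] keeps it where the partials are controlled. *)
pose k := Num.max `|a - z| `|b - z|.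
have kd : k < d by rewrite /k gt_max az.
have ak : `|a - z| <= k by rewrite /k le_max lexx.
have bk : `|b - z| <= k by rewrite /k le_max lexx orbT.
move: (ak) (bk); rewrite !norm_prod_le/= => /andP[ak1 ak2] /andP[bk1 bk2].
have box s t : `|s - z.1| <= k -> `|t - z.2| <= k -> `|(s, t) - z| < d.
  by move=> sk tk; apply: le_lt_trans kd; rewrite norm_prod_le/= sk.
have h1 : `|f (b.1, b.2) - f (a.1, b.2) - dx f z * (b.1 - a.1)|
    <= e / 2 * `|b.1 - a.1|.
  apply: (@derive_approx (fun t => f (t, b.2)) (fun t => dx f (t, b.2))
    a.1 b.1 z.1 k) ak1 bk1 => t tk; have [Dw hx _] := dP _ (box _ _ tk bk2).
    have [dfx _ _ _] := fD _ Dw; exact: slice_x dfx.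
  exact: hx.
have h2 : `|f (a.1, b.2) - f (a.1, a.2) - dy f z * (b.2 - a.2)|
    <= e / 2 * `|b.2 - a.2|.
  apply: (@derive_approx (fun t => f (a.1, t)) (fun t => dy f (a.1, t))
    a.2 b.2 z.2 k) ak2 bk2 => t tk; have [Dw _ hy] := dP _ (box _ _ ak1 tk).
    have [_ dfy _ _] := fD _ Dw; exact: slice_y dfy.
  exact: hy.
have -> : f b - f a - linform (dx f z) (dy f z) (b - a) =
    (f (b.1, b.2) - f (a.1, b.2) - dx f z * (b.1 - a.1)) +
    (f (a.1, b.2) - f (a.1, a.2) - dy f z * (b.2 - a.2)).
  by rewrite /linform -!surjective_pairing/=; ring.
rewrite (le_trans (ler_normD _ _))// [X in _ <= X * _]splitr mulrDl.
have := lexx `|b - a|; rewrite {1}norm_prod_le/= => /andP[l1 l2].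
by apply: lerD; [apply: le_trans h1 _|apply: le_trans h2 _];
  apply: ler_wpM2l => //; exact: ltW.
Qed.

Lemma C1_differentiable D f z : open D -> C1_on D f -> D z ->
  differentiable f z.
Proof.
move=> oD fD Dz.
apply: (proj1 (@differentiable_approx _ _ _ f (linform (dx f z) (dy f z)) z
  (@linform_continuous _ _) _)).
move=> e e0; have [d d0 H] := C1_strict oD fD Dz e0.
apply: filterS (near_dist_lt z d0) => y yz.
by apply: H => //; rewrite subrr normr0.
Qed.

Lemma diff_partials f z v : differentiable f z ->
  'd f z v = linform (dx f z) (dy f z) v.
Proof.
move=> df; rewrite /dx /dy /linform !deriveE//.
have {1}-> : v = v.1 *: ((1, 0) : R * R) + v.2 *: ((0, 1) : R * R).
  by case: v => s t; apply/pair_equal_spec; split;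
    rewrite /= /GRing.scale/= !(mulr1, mulr0) ?addr0 ?add0r.
by rewrite linearD !linearZ/= /GRing.scale/= mulrC [X in _ + X]mulrC.
Qed.

Implicit Types (phi : R * R -> R * R).

Definition C1_map D phi :=
  C1_on D (fun z => (phi z).1) /\ C1_on D (fun z => (phi z).2).

Lemma C1_map_continuous D phi z : open D -> C1_map D phi -> D z ->
  {for z, continuous phi}.
Proof.
move=> oD [pD qD] Dz.
have cp := differentiable_continuous (C1_differentiable oD pD Dz).
have cq := differentiable_continuous (C1_differentiable oD qD Dz).
have c : ((phi w).1, (phi w).2) @[w --> z] --> ((phi z).1, (phi z).2).
  exact: (cvg_pair cp cq).
have E : (fun w => ((phi w).1, (phi w).2)) = phi.
  by apply/funext => w; rewrite -surjective_pairing.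
by move: c; rewrite E -surjective_pairing.
Qed.

(** * Newton's map with frozen derivative, and local surjectivity *)

Definition jacdet phi z : R :=
  dx (fun w => (phi w).1) z * dy (fun w => (phi w).2) z
  - dy (fun w => (phi w).1) z * dx (fun w => (phi w).2) z.

Definition linmap (a b c d : R) z : R * R := (linform a b z, linform c d z).

Lemma linmapB a b c d u v :
  linmap a b c d (u - v) = linmap a b c d u - linmap a b c d v.
Proof. by rewrite /linmap !linearB. Qed.

Lemma linmap_bound a b c d :
  exists2 K, 0 < K & forall u, `|linmap a b c d u| <= K * `|u|.
Proof.
exists (1 + (`|a| + `|b|) + (`|c| + `|d|)).
  by rewrite -addrA ltr_pwDl// !addr_ge0.
move=> u; rewrite norm_prod_le/=; apply/andP; split;
  apply: le_trans (linform_bound _ _ _) _; apply: ler_wpM2r => //.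
  by rewrite addrAC lerDr addr_ge0// addr_ge0.
by rewrite lerDr addr_ge0// addr_ge0.
Qed.

Lemma linmap_continuous a b c d : continuous (linmap a b c d).
Proof.
move=> u.
exact: (cvg_pair (@linform_continuous a b u) (@linform_continuous c d u)).
Qed.

(* The inverse of the differential of phi at z. *)
Definition invdiff phi z : R * R -> R * R :=
  linmap (dy (fun w => (phi w).2) z / jacdet phi z)
         (- (dy (fun w => (phi w).1) z / jacdet phi z))
         (- (dx (fun w => (phi w).2) z / jacdet phi z))
         (dx (fun w => (phi w).1) z / jacdet phi z).

Lemma invdiffK phi z v : jacdet phi z != 0 ->
  invdiff phi z
    (linform (dx (fun w => (phi w).1) z) (dy (fun w => (phi w).1) z) v,
     linform (dx (fun w => (phi w).2) z) (dy (fun w => (phi w).2) z) v)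
  = v.
Proof.
case: v => s t; rewrite /invdiff /linmap /linform /jacdet /=.
set px := dx (fun w => (phi w).1) z; set qx := dx (fun w => (phi w).2) z.
set py := dy (fun w => (phi w).1) z; set qy := dy (fun w => (phi w).2) z => J0.
by apply/pair_equal_spec; split; field.
Qed.

(** This is the other one-sided inverse: the two rows of the differential of [phi], applied to
    [invdiff phi z u], give back the components of [u]. *)
Lemma invdiff_inj0 phi z u : jacdet phi z != 0 -> invdiff phi z u = 0 -> u = 0.
Proof.
case: u => s t; rewrite /invdiff /linmap /linform /jacdet /=.
set px := dx (fun w => (phi w).1) z; set qx := dx (fun w => (phi w).2) z.
set py := dy (fun w => (phi w).1) z; set qy := dy (fun w => (phi w).2) z => J0.
move=> /pair_equal_spec[/= e1 e2]; apply/pair_equal_spec; split.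
  transitivity (px * (qy / (px * qy - py * qx) * s +
      - (py / (px * qy - py * qx)) * t) +
    py * (- (qx / (px * qy - py * qx)) * s + px / (px * qy - py * qx) * t)).
    by field.
  by rewrite e1 e2 !mulr0 addr0.
transitivity (qx * (qy / (px * qy - py * qx) * s +
    - (py / (px * qy - py * qx)) * t) +
  qy * (- (qx / (px * qy - py * qx)) * s + px / (px * qy - py * qx) * t)).
  by field.
by rewrite e1 e2 !mulr0 addr0.
Qed.

Lemma newton_strict D phi z e : open D -> C1_map D phi -> D z ->
  jacdet phi z != 0 -> 0 < e ->
  exists2 d : R, 0 < d & forall a b, `|a - z| < d -> `|b - z| < d ->
    `|b - a - invdiff phi z (phi b - phi a)| <= e * `|b - a|.
Proof.
move=> oD [pD qD] Dz J0 e0;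
have [K K0 HK] : exists2 K, 0 < K & forall u, `|invdiff phi z u| <= K * `|u|.
  exact: linmap_bound.
have eK0 : 0 < e / K by rewrite divr_gt0.
have [d1 d10 H1] := C1_strict oD pD Dz eK0.
have [d2 d20 H2] := C1_strict oD qD Dz eK0.
exists (Num.min d1 d2); first by rewrite lt_min d10.
move=> a b; rewrite !lt_min => /andP[az1 az2] /andP[bz1 bz2].
rewrite -{1}(invdiffK (b - a) J0) -linmapB (le_trans (HK _))//.
rewrite mulrC -ler_pdivlMr// mulrAC norm_prod_le/=.
rewrite distrC H1// distrC H2//.
Qed.

(** With Lipschitz constant 1/2 the triangle inequality absorbs half of |b - a|, so displacements
    are controlled by their images; local injectivity follows. *)
Lemma newton_half D phi z : open D -> C1_map D phi -> D z ->
  jacdet phi z != 0 ->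
  exists2 d : R, 0 < d & forall a b, `|a - z| < d -> `|b - z| < d ->
    `|b - a - invdiff phi z (phi b - phi a)| <= 2^-1 * `|b - a| /\
    `|b - a| <= 2 * `|invdiff phi z (phi b - phi a)|.
Proof.
move=> oD pD Dz J0; have h0 : 0 < 2^-1 :> R by rewrite invr_gt0.
have [d d0 H] := newton_strict oD pD Dz J0 h0.
exists d => // a b az bz; have h := H a b az bz; split=> //.
have := ler_normD (b - a - invdiff phi z (phi b - phi a))
  (invdiff phi z (phi b - phi a)); rewrite subrK; lra.
Qed.

Lemma box_compact z (r : R) : compact [set a : R * R | `|a - z| <= r].
Proof.
have -> : [set a : R * R | `|a - z| <= r] =
    `[z.1 - r, z.1 + r]%classic `*` `[z.2 - r, z.2 + r]%classic.
  apply/seteqP; split=> a /=; rewrite norm_prod_le/= !in_itv/= !ler_distl.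
    by move=> /andP[].
  by move=> [-> ->].
by apply: compact_setX; exact: segment_compact.
Qed.

(* A minimizer a of |invdiff (w - phi a)| over a small closed box must be
   a zero, since the Newton step from a stays in the box and halves that
   quantity. *)
Lemma local_surjective D phi z r : open D -> C1_map D phi -> D z ->
  jacdet phi z != 0 -> 0 < r ->
  \forall w \near phi z, exists2 a, `|a - z| <= r & phi a = w.
Proof.
move=> oD pD Dz J0 r0.
have [d d0 Hd] := newton_half oD pD Dz J0.
have [c c0 cD] := near_box oD Dz.

have [K K0 HK] : exists2 K, 0 < K & forall u, `|invdiff phi z u| <= K * `|u|.
  exact: linmap_bound.
(* [c] keeps the square in [D], [d] gives the Newton estimates, [r] is the radius requested; halving
   leaves strict inequalities on the closed square. *)
pose m := Num.min c (Num.min d r); have m0 : 0 < m by rewrite !lt_min c0 d0.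
pose s := m / 2; have s0 : 0 < s by rewrite divr_gt0.
have sm : s < m by rewrite /s ltr_pdivrMr// ltr_pMr// ltr1n.
have {sm} /andP[sc /andP[sd sr]] : (s < c) && ((s < d) && (s < r)).
  by rewrite -!lt_min.
(* The constant is 5 = 4 + 1: a minimizer satisfies |a - z| <= 2 (N z + N a) <= 4 N z, and the
   Newton step from it has length N a <= N z. The factor K converts the bound on |w - phi z| into
   one on N z. *)
have t0 : 0 < s / (5 * K) by rewrite divr_gt0// mulr_gt0.
apply: filterS (near_dist_lt (phi z) t0) => w wz.
pose N a := `|invdiff phi z (w - phi a)|.
pose A := [set a : R * R | `|a - z| <= s].
have Az : A z by rewrite /A/= subrr normr0 ltW.
have [|a /set_mem Aa amin] :=
    @compact_EVT_min _ _ N A (ex_intro _ z Az) (@box_compact z s).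
  apply: continuous_in_subspaceT => a /set_mem Aa.
  apply: cvg_norm; apply: (continuous_cvg _ (@linmap_continuous _ _ _ _ _)).
  apply: cvgB; first exact: cvg_cst.
  by apply: (C1_map_continuous oD pD); apply: cD; exact: le_lt_trans Aa sc.
have Ns : 5 * N z < s.
  rewrite /N mulrC -ltr_pdivlMr//; apply: le_lt_trans (HK _) _.
  by rewrite mulrC -ltr_pdivlMr// -mulrA -invfM.
have zd : `|z - z| < d by rewrite subrr normr0.
have ad : `|a - z| < d by exact: le_lt_trans Aa sd.
have Na : N a <= N z by apply: amin; exact/mem_set.
have az : `|a - z| <= 4 * N z.
  have [_ /le_trans] := Hd z a zd ad; apply.
  have -> : invdiff phi z (phi a - phi z) =
      invdiff phi z (w - phi z) - invdiff phi z (w - phi a).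
    by rewrite -linmapB opprB [w - _ + _]addrC addrA subrK.
  have := ler_normB (invdiff phi z (w - phi z)) (invdiff phi z (w - phi a)).
  rewrite -/(N z) -/(N a); lra.
pose b := a + invdiff phi z (w - phi a).
have bs : `|b - z| <= s.
  have -> : b - z = (a - z) + invdiff phi z (w - phi a) by rewrite /b addrAC.
  apply: le_trans (ler_normD _ _) _; rewrite -/(N a); lra.
have [Hb _] := Hd a b ad (le_lt_trans bs sd).
have ba : b - a = invdiff phi z (w - phi a) by rewrite /b addrAC subrr add0r.
(* Since b - a is exactly the Newton step, the error term of [newton_half] between [a] and [b]
   equals [invdiff] of w - phi b. *)
have Nb : N b <= 2^-1 * N a.
  move: Hb; rewrite ba -linmapB /N.
  by rewrite opprB addrA subrK.
have Nab : N a <= N b by apply: amin; exact/mem_set.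
have Na0 : invdiff phi z (w - phi a) = 0.
  apply/eqP; rewrite -normr_eq0 -/(N a).
  have := normr_ge0 (invdiff phi z (w - phi a)).
  rewrite -/(N a) => ?; apply/eqP; lra.
exists a; first exact: ltW (le_lt_trans Aa sr).
by apply/eqP; rewrite eq_sym -subr_eq0; apply/eqP/(invdiff_inj0 J0).
Qed.

End PlaneCalculus.

(** * The inverse function theorem in the plane *)

Section InverseFunction.
Context {R : realType}.
Implicit Types (D E U : set (R * R)) (f : R * R -> R) (z w : R * R).
Implicit Types (phi : R * R -> R * R).

Lemma eq_in_continuous (V : topologicalType) E (f h : R * R -> V) w :
  open E -> E w -> (forall v, E v -> f v = h v) ->
  {for w, continuous h} -> {for w, continuous f}.
Proof.
move=> oE Ew fh; rewrite /prop_for /continuous_at (fh w Ew).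
apply: cvg_trans; apply: near_eq_cvg.
have nE : \forall v \near w, E v by exact: open_nbhs_nbhs.
by apply: filterS nE => v /fh.
Qed.

Lemma C1_onI D f (fx fy : R * R -> R) : open D ->
  (forall z, D z -> differentiable f z) ->
  (forall z, D z -> dx f z = fx z) -> (forall z, D z -> dy f z = fy z) ->
  (forall z, D z -> {for z, continuous fx}) ->
  (forall z, D z -> {for z, continuous fy}) -> C1_on D f.
Proof.
move=> oD df fxE fyE cx cy z Dz; split.
- exact: diff_derivable (df z Dz).
- exact: diff_derivable (df z Dz).
- exact: eq_in_continuous oD Dz fxE (cx z Dz).
- exact: eq_in_continuous oD Dz fyE (cy z Dz).
Qed.

Lemma comp_partials f (g : R * R -> R * R) w : differentiable f (g w) ->
  differentiable (fun v => (g v).1) w -> differentiable (fun v => (g v).2) w ->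
  [/\ differentiable (f \o g) w,
    dx (f \o g) w = dx f (g w) * dx (fun v => (g v).1) w +
                    dy f (g w) * dx (fun v => (g v).2) w &
    dy (f \o g) w = dx f (g w) * dy (fun v => (g v).1) w +
                    dy f (g w) * dy (fun v => (g v).2) w].
Proof.
move=> df dg1 dg2.
have E : (fun v => ((g v).1, (g v).2)) = g.
  by apply/funext => v; rewrite -surjective_pairing.
have dg : differentiable g w by rewrite -E; exact: differentiable_pair.
have dfg : differentiable (f \o g) w by exact: differentiable_comp.
have D v : 'D_v (f \o g) w = dx f (g w) * 'D_v (fun v => (g v).1) w +
                    dy f (g w) * 'D_v (fun v => (g v).2) w.
  rewrite (deriveE _ dfg) (deriveE _ dg1) (deriveE _ dg2).
  rewrite (diff_comp dg df) [LHS](diff_partials _ df).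
  have -> : 'd g w v = ('d (fun v => (g v).1) w v, 'd (fun v => (g v).2) w v).
    have := congr1 (fun h => h v) (diff_pair dg1 dg2); rewrite E; exact.
  reflexivity.
by split; [exact: dfg|exact: D|exact: D].
Qed.

Lemma C1_comp D E f (g : R * R -> R * R) : open D -> open E -> C1_on D f ->
  C1_map E g -> (forall w, E w -> D (g w)) -> C1_on E (f \o g).
Proof.
move=> oD oE fD [g1 g2] gED.
have P w (Ew : E w) := comp_partials (C1_differentiable oD fD (gED w Ew))
  (C1_differentiable oE g1 Ew) (C1_differentiable oE g2 Ew).
have c (h : R * R -> R) w : E w -> {for g w, continuous h} ->
    {for w, continuous (h \o g)}.
  move=> Ew ch; apply: continuous_comp => //.
  exact: (C1_map_continuous oE (conj g1 g2) Ew).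
have Q w (Ew : E w) := fD _ (gED w Ew).
pose fx w := dx f (g w) * dx (fun v => (g v).1) w +
             dy f (g w) * dx (fun v => (g v).2) w.
pose fy w := dx f (g w) * dy (fun v => (g v).1) w +
             dy f (g w) * dy (fun v => (g v).2) w.
apply: (@C1_onI E _ fx fy oE) => w Ew; have [dfg ex ey] := P w Ew.
- exact: dfg.
- exact: ex.
- exact: ey.
- have [_ _ cx cy] := Q w Ew.
  have [_ _ cx1 _] := g1 w Ew; have [_ _ cx2 _] := g2 w Ew.
  exact: cvgD (cvgM (c _ _ Ew cx) cx1) (cvgM (c _ _ Ew cy) cx2).
- have [_ _ cx cy] := Q w Ew.
  have [_ _ _ cy1] := g1 w Ew; have [_ _ _ cy2] := g2 w Ew.
  exact: cvgD (cvgM (c _ _ Ew cx) cy1) (cvgM (c _ _ Ew cy) cy2).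
Qed.

(** * Regularity of an arbitrary left inverse *)

Section LeftInverse.
Variables (U : set (R * R)) (phi : R * R -> R * R).
Hypotheses (oU : open U) (phiU : C1_map U phi)
  (J0 : forall z, U z -> jacdet phi z != 0).

Lemma open_image : open (phi @` U).
Proof.
rewrite openE => _ [z Uz <-]; have [c c0 cU] := near_box oU Uz.
have c20 : 0 < c / 2 by rewrite divr_gt0.
apply: filterS (local_surjective oU phiU Uz (J0 Uz) c20) => w [a az <-].
exists a => //; apply: cU; apply: le_lt_trans az _.
by rewrite ltr_pdivrMr// ltr_pMr// ltr1n.
Qed.

Lemma local_injective z : U z -> exists2 d, 0 < d &
  (forall a, `|a - z| < d -> U a) /\
  (forall a b, `|a - z| < d -> `|b - z| < d -> phi a = phi b -> a = b).
Proof.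
move=> Uz; have [c c0 cU] := near_box oU Uz.
have [d d0 H] := newton_half oU phiU Uz (J0 Uz).
exists (Num.min c d); first by rewrite lt_min c0.
split=> [a|a b]; first by rewrite lt_min => /andP[/cU].
rewrite !lt_min => /andP[_ ad] /andP[_ bd] e.
have [_] := H a b ad bd; rewrite e subrr.
have -> : invdiff phi z 0 = 0.
  by rewrite -(subrr z) /invdiff linmapB !subrr.
by rewrite normr0 mulr0 normr_le0 subr_eq0 => /eqP.
Qed.

Variable g : R * R -> R * R.
Hypothesis gK : forall z, U z -> g (phi z) = z.

(** No continuity of [g] is assumed. Local surjectivity writes each w near phi z as phi a with a
    near z, so g w = a, and [newton_strict] between z and a is the required estimate. The bound |a -
    z| <= 2 K |w - phi z| explains the tolerance e / (2 K). *)
Lemma left_inverse_approx z e : U z -> 0 < e ->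
  \forall w \near phi z,
    `|g w - z - invdiff phi z (w - phi z)| <= e * `|w - phi z|.
Proof.
move=> Uz e0; have [c c0 cU] := near_box oU Uz.

have [K K0 HK] : exists2 K, 0 < K & forall u, `|invdiff phi z u| <= K * `|u|.
  exact: linmap_bound.
have eK0 : 0 < e / (2 * K) by rewrite divr_gt0// mulr_gt0.
have [d d0 Hd] := newton_half oU phiU Uz (J0 Uz).
have [k k0 Hk] := newton_strict oU phiU Uz (J0 Uz) eK0.
pose m := Num.min c (Num.min d k); have m0 : 0 < m by rewrite !lt_min c0 d0.
pose s := m / 2; have s0 : 0 < s by rewrite divr_gt0.
have sm : s < m by rewrite /s ltr_pdivrMr// ltr_pMr// ltr1n.
have {sm} /andP[sc /andP[sd sk]] : (s < c) && ((s < d) && (s < k)).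
  by rewrite -!lt_min.
apply: filterS (local_surjective oU phiU Uz (J0 Uz) s0) => _ [a az <-].
rewrite gK; last by apply: cU; exact: le_lt_trans az sc.
have zz r : 0 < r -> `|z - z| < r by rewrite subrr normr0.
have [_ h1] := Hd z a (zz _ d0) (le_lt_trans az sd).
have h2 := Hk z a (zz _ k0) (le_lt_trans az sk).
apply: le_trans h2 _; rewrite -mulrA ler_pM2l// mulrC ler_pdivrMr ?mulr_gt0//.
apply: le_trans h1 _; rewrite [leRHS]mulrC -mulrA ler_pM2l//; exact: HK.
Qed.

Lemma left_inverse_partials z : U z ->
  [/\ differentiable (fun w => (g w).1) (phi z),
      differentiable (fun w => (g w).2) (phi z),
      dx (fun w => (g w).1) (phi z) =
        dy (fun w => (phi w).2) z / jacdet phi z /\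
      dy (fun w => (g w).1) (phi z) =
        - (dy (fun w => (phi w).1) z / jacdet phi z) &
      dx (fun w => (g w).2) (phi z) =
        - (dx (fun w => (phi w).2) z / jacdet phi z) /\
      dy (fun w => (g w).2) (phi z) =
        dx (fun w => (phi w).1) z / jacdet phi z].
Proof.
move=> Uz.
have val (f : R * R -> R) a b : differentiable f (phi z) /\
    'd f (phi z) = linform a b :> (R * R -> R) ->
    dx f (phi z) = a /\ dy f (phi z) = b.
  move=> [df dE]; rewrite /dx /dy !deriveE// dE /linform/=.
  by rewrite !(mulr1, mulr0) addr0 add0r.
have d1 := @differentiable_approx _ _ _ (fun w => (g w).1) _ (phi z)
  (@linform_continuous _ (dy (fun w => (phi w).2) z / jacdet phi z)
         (- (dy (fun w => (phi w).1) z / jacdet phi z))).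
have d2 := @differentiable_approx _ _ _ (fun w => (g w).2) _ (phi z)
  (@linform_continuous _ (- (dx (fun w => (phi w).2) z / jacdet phi z))
         (dx (fun w => (phi w).1) z / jacdet phi z)).
have {}d1 := d1 _; have {}d2 := d2 _.
have [e1 e2] : (forall e, 0 < e -> \forall w \near phi z,
     `|(g w).1 - (g (phi z)).1 - (invdiff phi z (w - phi z)).1|
       <= e * `|w - phi z|)
   /\ (forall e, 0 < e -> \forall w \near phi z,
     `|(g w).2 - (g (phi z)).2 - (invdiff phi z (w - phi z)).2|
       <= e * `|w - phi z|).
  by split=> e e0; apply: filterS (left_inverse_approx Uz e0) => w;
    rewrite (gK Uz) norm_prod_le/= => /andP[].
have {}d1 := d1 e1; have {}d2 := d2 e2.
by split; [exact: (proj1 d1)|exact: (proj1 d2)|exact: val d1|exact: val d2].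
Qed.

(** At w = phi z the partials of [g] are entries of the inverse Jacobian matrix at z = g w, hence
    continuous functions composed with [g], which is continuous because it is differentiable. *)
Lemma left_inverse_C1 : C1_map (phi @` U) g.
Proof.
have oV := open_image; have [pU qU] := phiU.
have gc w : (phi @` U) w -> {for w, continuous g}.
  move=> [z Uz <-]; have [d1 d2 _ _] := left_inverse_partials Uz.
  have c : ((g w).1, (g w).2) @[w --> phi z] --> ((g (phi z)).1, (g (phi z)).2).
    exact: (cvg_pair (differentiable_continuous d1)
      (differentiable_continuous d2)).
  have E : (fun w => ((g w).1, (g w).2)) = g.
    by apply/funext => v; rewrite -surjective_pairing.
  by move: c; rewrite E -surjective_pairing.
have comp (h : R * R -> R) w : (phi @` U) w ->
    (forall z, U z -> {for z, continuous h}) -> {for w, continuous (h \o g)}.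
  move=> Vw hc; apply: continuous_comp; first exact: gc.
  by case: Vw => z Uz <-; rewrite gK//; exact: hc.
have Jc z : U z -> {for z, continuous (jacdet phi)}.
  move=> Uz; have [_ _ px py] := pU z Uz; have [_ _ qx qy] := qU z Uz.
  exact: cvgB (cvgM px qy) (cvgM py qx).
have divJ (h : R * R -> R) z : U z -> {for z, continuous h} ->
    {for z, continuous (fun v => h v / jacdet phi v)}.
  by move=> Uz hc; exact: cvgM hc (cvgV (J0 Uz) (Jc z Uz)).
have key (h a b : R * R -> R) :
  (forall z, U z -> [/\ differentiable h (phi z), dx h (phi z) = a z &
    dy h (phi z) = b z]) ->
  (forall z, U z -> {for z, continuous a}) ->
  (forall z, U z -> {for z, continuous b}) -> C1_on (phi @` U) h.
  move=> hP ac bc; apply: (@C1_onI _ h (a \o g) (b \o g) oV).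
  - by move=> _ [z Uz <-]; case: (hP z Uz).
  - by move=> _ [z Uz <-]; case: (hP z Uz) => _ /= -> _; rewrite gK.
  - by move=> _ [z Uz <-]; case: (hP z Uz) => _ /= _ ->; rewrite gK.
  - by move=> w Vw; exact: comp.
  - by move=> w Vw; exact: comp.
have Dp z (Uz : U z) := pU z Uz; have Dq z (Uz : U z) := qU z Uz.
split.
  apply: (key _ (fun z => dy (fun w => (phi w).2) z / jacdet phi z)
    (fun z => - (dy (fun w => (phi w).1) z / jacdet phi z))) => z Uz.
  - by have [d1 _ [e1 e2] _] := left_inverse_partials Uz; split.
  - by have [_ _ _ qy] := Dq z Uz; exact: divJ Uz qy.
  - by have [_ _ _ py] := Dp z Uz; exact: cvgN (divJ _ _ Uz py).
apply: (key _ (fun z => - (dx (fun w => (phi w).2) z / jacdet phi z))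
  (fun z => dx (fun w => (phi w).1) z / jacdet phi z)) => z Uz.
- by have [_ d1 _ [e1 e2]] := left_inverse_partials Uz; split.
- by have [_ _ qx _] := Dq z Uz; exact: cvgN (divJ _ _ Uz qx).
- by have [_ _ px _] := Dp z Uz; exact: divJ Uz px.
Qed.
End LeftInverse.

Lemma local_diffeo U phi z : open U -> C1_map U phi ->
  (forall z, U z -> jacdet phi z != 0) -> U z ->
  exists V g, V z /\ C1_diffeo V phi g.
Proof.
move=> oU phiU J0 Uz; have [d d0 [dU inj]] := local_injective oU phiU J0 Uz.
pose V := [set a : R * R | `|a - z| < d].
have oV : open V.
  rewrite openE => a Va; have da : 0 < d - `|a - z| by rewrite subr_gt0.
  apply: filterS (near_dist_lt a da) => b ba; rewrite /V/=.
  rewrite -(subrKA a) (le_lt_trans (ler_normD _ _))//.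
  by rewrite -ltrBrDr.
have phiV : C1_map V phi.
  by split=> a /dU Ua; case: phiU => h1 h2; [exact: h1|exact: h2].
have JV a : V a -> jacdet phi a != 0 by move=> /dU /J0.
(* On the image of the ball [V] injectivity makes this choice the inverse; elsewhere [g] takes the
   default value [z], which is harmless because [C1_diffeo] only constrains it on the image. *)
pose g w := xget z [set a | V a /\ phi a = w].
have gK a : V a -> g (phi a) = a.
  move=> Va; rewrite /g; case: xgetP => [b _ [Vb e]|/(_ a)[]//].
  exact: inj.
exists V, g; split; first by rewrite /V/= subrr normr0.
split; [by split=> //; exact: open_image oV phiV JV|exact: phiV|exact: gK|].
have gC := left_inverse_C1 oV phiV JV gK.
exact: gC.
Qed.

End InverseFunction.

(** * Evaluation of the fiber algebras at the spectral parameter *)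

Lemma invC2 (R : realType) : 2^-1 = (2^-1)%:C :> R[i].
Proof. by rewrite fmorphV/= rmorph_nat. Qed.

Section Fiber.
Context {R : realType}.
Variables al be : R * R -> R.
Implicit Types z : R * R.

Lemma struct_poly_size z : size (struct_poly al be z) = 3%N.
Proof.
rewrite /struct_poly -addrA size_polyDl ?size_polyXn//.
rewrite ltnS (leq_trans (size_polyD _ _))// geq_max size_polyC.
by rewrite (leq_trans (size_scale_leq _ _)) ?size_polyX//; case: eqP.
Qed.

Lemma struct_poly_monic z : struct_poly al be z \is monic.
Proof.
rewrite monicE /struct_poly -addrA lead_coefDl ?lead_coefXn//.
rewrite size_polyXn ltnS (leq_trans (size_polyD _ _))// geq_max size_polyC.
by rewrite (leq_trans (size_scale_leq _ _)) ?size_polyX//; case: eqP.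
Qed.

(** The quotient is formed modulo [mk_monic p], which is [p] only when [p] is monic and nonconstant;
    this identifies the modulus with the structure polynomial. *)
Lemma mk_monic_struct z : mk_monic (struct_poly al be z) = struct_poly al be z.
Proof. by rewrite /mk_monic struct_poly_size struct_poly_monic. Qed.

Definition fiber_eval z (a : fiber al be z) : R[i] :=
  (map_poly (real_complex R) (a : {poly R})).[lam al be z].

(** Representatives have degree below 2, so evaluation is the formula of [transport]; this lets
    [transport] inherit the algebraic rules below. *)
Lemma fiber_evalE z (a : fiber al be z) :
  fiber_eval a = ((a : {poly R})`_0)%:C + ((a : {poly R})`_1)%:C * lam al be z.
Proof.
rewrite /fiber_eval (@horner_coef_wide _ 2).
  by rewrite !big_ord_recl big_ord0 /= !coef_map/= expr0 mulr1 addr0.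
have sa : (size (a : {poly R}) <= 2)%N.
  rewrite -ltnS (leq_trans (size_mk_monic a))//.
  by rewrite mk_monic_struct struct_poly_size.
by apply: leq_trans sa; exact: size_poly.
Qed.

Lemma fiber_evalD z (a b : fiber al be z) :
  fiber_eval (a + b) = fiber_eval a + fiber_eval b.
Proof. by rewrite /fiber_eval poly_of_qpolyD rmorphD hornerD. Qed.

Lemma fiber_evalZ z k (a : fiber al be z) :
  fiber_eval (k *: a) = k%:C * fiber_eval a.
Proof. by rewrite /fiber_eval poly_of_qpolyZ linearZ/= hornerZ. Qed.

Lemma fiber_eval1 z : fiber_eval (1 : fiber al be z) = 1.
Proof. by rewrite /fiber_eval /= rmorph1 hornerC. Qed.

Lemma fiber_eval0 z : fiber_eval (0 : fiber al be z) = 0.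
Proof. by rewrite /fiber_eval /= rmorph0 horner0. Qed.

Lemma gen_coef z : (gen al be z : {poly R}) = 'X.
Proof. by rewrite /gen qpolyXE ?struct_poly_size ?struct_poly_monic. Qed.

Lemma fiber_eval_gen z : fiber_eval (gen al be z) = lam al be z.
Proof. by rewrite /fiber_eval gen_coef map_polyX hornerX. Qed.

Definition re_lam z : R := - be z / 2.
Definition im_lam z : R := Num.sqrt (discr al be z) / 2.

Lemma lamE z : lam al be z = re_lam z +i* im_lam z.
Proof.
rewrite /lam /re_lam /im_lam invC2.
by apply/eqP; rewrite eq_complex /=; simpc.
Qed.

Lemma im_lam_sqr z : 0 <= discr al be z ->
  im_lam z ^+ 2 = al z - be z ^+ 2 / 4.
Proof.
by move=> d0; rewrite /im_lam expr_div_n sqr_sqrtr// /discr; field.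
Qed.

Lemma im_lam_gt0 z : 0 < discr al be z -> 0 < im_lam z.
Proof. by move=> d0; rewrite divr_gt0// sqrtr_gt0. Qed.

(** * The fiber algebra at a point of positive discriminant *)

Section Positive.
Variable z : R * R.
Hypothesis dz : 0 < discr al be z.

Lemma struct_poly_lam :
  (map_poly (real_complex R) (struct_poly al be z)).[lam al be z] = 0.
Proof.
rewrite /struct_poly !rmorphD/= rmorphXn/= linearZ/= map_polyX map_polyC/=.
rewrite !hornerD hornerXn hornerZ hornerX hornerC !lamE expr2.
apply/eqP; rewrite eq_complex/=; simpc; rewrite /= ?mul0r ?mulr0 ?subr0 ?addr0.
have := im_lam_sqr (ltW dz); rewrite /re_lam expr2 => E.
apply/andP; split; apply/eqP; [|by field].
rewrite E; by field.
Qed.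

(** A product in the fiber is a remainder modulo the structure polynomial; the discarded multiple
    vanishes at its root lambda. *)
Lemma fiber_evalM (a b : fiber al be z) :
  fiber_eval (a * b) = fiber_eval a * fiber_eval b.
Proof.
rewrite /fiber_eval poly_of_qpolyM -hornerM -rmorphM.
move: ((a : {poly R}) * (b : {poly R})) => p; rewrite mk_monic_struct.
rewrite [in RHS](Pdiv.RingMonic.rdivp_eq (struct_poly_monic z) p).
by rewrite rmorphD rmorphM/= hornerD hornerM struct_poly_lam mulr0 add0r.
Qed.

Lemma fiber_evalN (a : fiber al be z) : fiber_eval (- a) = - fiber_eval a.
Proof. by rewrite -scaleN1r fiber_evalZ rmorphN1 mulN1r. Qed.

Lemma fiber_eval_div (a b : fiber al be z) : b \is a GRing.unit ->
  fiber_eval (a / b) * fiber_eval b = fiber_eval a.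
Proof. by move=> ub; rewrite -fiber_evalM divrK. Qed.

Lemma gen_sqr : gen al be z * gen al be z =
  - (be z *: gen al be z) - (al z)%:A.
Proof.
have P : struct_poly al be z = 'X * 'X + be z *: 'X + al z *: 1.
  by rewrite /struct_poly expr2 alg_polyC.
have : in_qpoly (struct_poly al be z) ('X * 'X + be z *: 'X + al z *: 1) = 0.
  rewrite -P; apply: val_inj => /=; rewrite mk_monic_struct.
  exact: Pdiv.RingMonic.rmodpp (struct_poly_monic z).
rewrite 2!in_qpolyD in_qpolyM 2!in_qpolyZ in_qpoly1 => /eqP.
by rewrite -addrA addr_eq0 opprD => /eqP.
Qed.

Lemma gen_unit : 2 * gen al be z + (be z)%:A \is a GRing.unit.
Proof.
apply/unitrPr; exists (- (discr al be z)^-1 *: (2 * gen al be z + (be z)%:A)).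
have [E2 E4] : (be z)%:A * (be z)%:A = (be z ^+ 2)%:A :> fiber al be z /\
    (4 * al z)%:A = 4 * (al z)%:A :> fiber al be z.
  split; first by rewrite -scalerAl mul1r scalerA.
  by rewrite -scalerA scaler_nat mulr_natl.
have xx : (2 * gen al be z + (be z)%:A) * (2 * gen al be z + (be z)%:A) =
    - (discr al be z)%:A.
  have -> : - (discr al be z)%:A =
      (be z)%:A * (be z)%:A - 4 * (al z)%:A :> fiber al be z.
    by rewrite E2 -E4 /discr scalerBl opprB.
  (* Scalars are turned into ring elements, so that the identity (2 i + beta)^2 = beta^2 - 4 alpha
     becomes commutative algebra modulo the relation for i^2. *)
  have := gen_sqr; rewrite -(mulr_algl (be z) (gen al be z)).
  move: (gen al be z) (be z)%:A (al z)%:A => g b a gg.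
  have -> : (2 * g + b) * (2 * g + b) = 4 * (g * g) + 4 * (b * g) + b * b.
    by ring.
  by rewrite gg; ring.
rewrite -scalerAr xx scalerN scaleNr opprK scalerA mulVf ?scale1r//.
by rewrite gt_eqF.
Qed.
End Positive.
End Fiber.

(** * Algebra of C^1 functions *)

Section C1Algebra.
Context {R : realType}.
Implicit Types (D : set (R * R)) (f g : R * R -> R) (z : R * R).

Lemma C1_cst D (k : R) : open D -> C1_on D (fun=> k).
Proof.
move=> oD; apply: (@C1_onI _ D _ (fun=> 0) (fun=> 0)) => // z _.
- by rewrite /dx derive_cst.
- by rewrite /dy derive_cst.
- exact: cvg_cst.
- exact: cvg_cst.
Qed.

Lemma linform_partials (a b : R) z :
  [/\ differentiable (linform a b) z, dx (linform a b) z = a &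
      dy (linform a b) z = b].
Proof.
have [|df dE] := @differentiable_approx _ _ _ (linform a b) _ z
  (@linform_continuous _ a b).
  move=> e e0; near=> w; rewrite -linearB subrr normr0 mulr_ge0//.
  exact: ltW.
have {}dE : 'd (linform a b) z = linform a b :> (R * R -> R) by exact: dE.
split; first exact: df.
- by rewrite /dx (deriveE _ df) dE /linform/= mulr1 mulr0 addr0.
- by rewrite /dy (deriveE _ df) dE /linform/= mulr1 mulr0 add0r.
Unshelve. all: by end_near. Qed.

Lemma C1_linform D (a b : R) : open D -> C1_on D (linform a b).
Proof.
move=> oD; apply: (@C1_onI _ D _ (fun=> a) (fun=> b)) => // z _;
  have [df ex ey] := linform_partials a b z.
- exact: df.
- exact: ex.
- exact: ey.
- exact: cvg_cst.
- exact: cvg_cst.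
Qed.

Lemma fst_partials z : dx (fun w : R * R => w.1) z = 1 /\
  dy (fun w : R * R => w.1) z = 0.
Proof.
have E : linform 1 0 = (fun w : R * R => w.1).
  by apply/funext => w; rewrite /linform mul1r mul0r addr0.
by have [_] := linform_partials 1 0 z; rewrite E.
Qed.

Lemma snd_partials z : dx (fun w : R * R => w.2) z = 0 /\
  dy (fun w : R * R => w.2) z = 1.
Proof.
have E : linform 0 1 = (fun w : R * R => w.2).
  by apply/funext => w; rewrite /linform mul1r mul0r add0r.
by have [_] := linform_partials 0 1 z; rewrite E.
Qed.

Lemma C1_fst D : open D -> C1_on D (fun w => w.1).
Proof.
move=> oD; rewrite (_ : (fun w => w.1) = linform 1 0); first exact: C1_linform.
by apply/funext => w; rewrite /linform mul1r mul0r addr0.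
Qed.

Lemma C1_snd D : open D -> C1_on D (fun w => w.2).
Proof.
move=> oD; rewrite (_ : (fun w => w.2) = linform 0 1); first exact: C1_linform.
by apply/funext => w; rewrite /linform mul1r mul0r add0r.
Qed.

Section Pointwise.
Variables (f g : R * R -> R) (z : R * R).
Hypotheses (df : differentiable f z) (dg : differentiable g z).

Lemma partialsD : dx (fun w => f w + g w) z = dx f z + dx g z /\
  dy (fun w => f w + g w) z = dy f z + dy g z.
Proof.
have E v := deriveD
  (@diff_derivable _ _ _ f z v df) (@diff_derivable _ _ _ g z v dg).
by split; [exact: (E (1, 0))|exact: (E (0, 1))].
Qed.

Lemma partialsM :
  dx (fun w => f w * g w) z = f z * dx g z + g z * dx f z /\
  dy (fun w => f w * g w) z = f z * dy g z + g z * dy f z.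
Proof.
have E v := deriveM
  (@diff_derivable _ _ _ f z v df) (@diff_derivable _ _ _ g z v dg).
by split; [exact: (E (1, 0))|exact: (E (0, 1))].
Qed.

Lemma partialsN :
  dx (fun w => - f w) z = - dx f z /\ dy (fun w => - f w) z = - dy f z.
Proof.
have E v := deriveN (@diff_derivable _ _ _ f z v df).
by split; [exact: (E (1, 0))|exact: (E (0, 1))].
Qed.

Lemma partials_sqrt : 0 < f z ->
  [/\ differentiable (fun w => Num.sqrt (f w)) z,
      dx (fun w => Num.sqrt (f w)) z = (2 * Num.sqrt (f z))^-1 * dx f z &
      dy (fun w => Num.sqrt (f w)) z = (2 * Num.sqrt (f z))^-1 * dy f z].
Proof.
move=> f0; have [ds Ds] := is_derive1_sqrt f0.
have dS : differentiable (@Num.sqrt R) (f z) by exact/derivable1_diffP.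
have dc : differentiable (@Num.sqrt R \o f) z by exact: differentiable_comp.
have D v : 'D_v (@Num.sqrt R \o f) z = (2 * Num.sqrt (f z))^-1 * 'D_v f z.
  have Es u : 'd (@Num.sqrt R) (f z) u = u * (2 * Num.sqrt (f z))^-1.
    by rewrite (deriv1E ds) derive1E Ds.
  have Ec : 'd (@Num.sqrt R \o f) z v = 'd (@Num.sqrt R) (f z) ('d f z v).
    exact: (congr1 (fun h => h v) (diff_comp df dS)).
  have Ef : 'D_v f z = 'd f z v := deriveE v df.
  have Esf : 'D_v (@Num.sqrt R \o f) z = 'd (@Num.sqrt R \o f) z v :=
    deriveE v dc.
  by rewrite Esf Ec Es Ef mulrC.
by split; [exact: dc|exact: D|exact: D].
Qed.
End Pointwise.

Section OnOpen.
Variables (D : set (R * R)) (f g : R * R -> R).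
Hypotheses (oD : open D) (fD : C1_on D f).

Let C1_continuous h z : C1_on D h -> D z -> {for z, continuous h}.
Proof.
by move=> hD Dz; exact: differentiable_continuous (C1_differentiable oD hD Dz).
Qed.

Lemma C1_add : C1_on D g -> C1_on D (fun w => f w + g w).
Proof.
move=> gD; apply: (@C1_onI _ D _ (fun w => dx f w + dx g w)
  (fun w => dy f w + dy g w) oD) => z Dz;
  have df := C1_differentiable oD fD Dz; have dg := C1_differentiable oD gD Dz;
  have [_ _ fx fy] := fD Dz; have [_ _ gx gy] := gD z Dz;
  have [ex ey] := partialsD df dg.
- exact: differentiableD df dg.
- exact: ex.
- exact: ey.
- exact: cvgD fx gx.
- exact: cvgD fy gy.
Qed.

Lemma C1_mul : C1_on D g -> C1_on D (fun w => f w * g w).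
Proof.
move=> gD; apply: (@C1_onI _ D _ (fun w => f w * dx g w + g w * dx f w)
  (fun w => f w * dy g w + g w * dy f w) oD) => z Dz;
  have df := C1_differentiable oD fD Dz; have dg := C1_differentiable oD gD Dz;
  have [_ _ fx fy] := fD Dz; have [_ _ gx gy] := gD z Dz;
  have [ex ey] := partialsM df dg;
  have cf := C1_continuous fD Dz; have cg := C1_continuous gD Dz.
- exact: differentiableM df dg.
- exact: ex.
- exact: ey.
- exact: cvgD (cvgM cf gx) (cvgM cg fx).
- exact: cvgD (cvgM cf gy) (cvgM cg fy).
Qed.

Lemma C1_opp : C1_on D (fun w => - f w).
Proof.
apply: (@C1_onI _ D _ (fun w => - dx f w) (fun w => - dy f w) oD) => z Dz;
  have df := C1_differentiable oD fD Dz; have [_ _ fx fy] := fD Dz;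
  have [ex ey] := partialsN df.
- exact: differentiableN df.
- exact: ex.
- exact: ey.
- exact: cvgN fx.
- exact: cvgN fy.
Qed.

Lemma C1_sqrt : (forall z, D z -> 0 < f z) ->
  C1_on D (fun w => Num.sqrt (f w)).
Proof.
move=> f0; apply: (@C1_onI _ D _ (fun w => (2 * Num.sqrt (f w))^-1 * dx f w)
  (fun w => (2 * Num.sqrt (f w))^-1 * dy f w) oD) => z Dz;
  have df := C1_differentiable oD fD Dz; have [_ _ fx fy] := fD Dz;
  have [ds ex ey] := partials_sqrt df (f0 z Dz);
  have cs : {for z, continuous (fun w => (2 * Num.sqrt (f w))^-1)}.
1,3,5,7,9: apply: cvgV; [by rewrite mulf_neq0// gt_eqF// sqrtr_gt0 f0|];
  apply: cvgM; [exact: cvg_cst|exact: differentiable_continuous ds].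
- exact: ds.
- exact: ex.
- exact: ey.
- exact: cvgM cs fx.
- exact: cvgM cs fy.
Qed.
End OnOpen.

End C1Algebra.

(** * Rigidity and transport *)

Section Spectral.
Context {R : realType}.
Variables (al be : R * R -> R) (Om : set (R * R)).
Hypotheses (oOm : open Om) (ell : elliptic_structure al be Om).
Implicit Types (z : R * R).

Notation la := (re_lam be).
Notation lb := (im_lam al be).

Lemma elliptic_C1 : [/\ C1_on Om al, C1_on Om be, C1_on Om (discr al be),
  C1_on Om la & C1_on Om lb].
Proof.
have [aC bC d0] := ell.
have dC : C1_on Om (discr al be).
  exact: C1_add oOm (C1_mul oOm (C1_cst 4 oOm) aC)
    (C1_opp oOm (C1_mul oOm bC bC)).
split; [exact: aC|exact: bC|exact: dC| |].
  exact: C1_mul oOm (C1_opp oOm bC) (C1_cst 2^-1 oOm).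
exact: C1_mul oOm (C1_sqrt oOm dC d0) (C1_cst 2^-1 oOm).
Qed.

(** Obtained by differentiating Re lambda = - beta / 2 and Im lambda = sqrt(discr) / 2. Together
    these are (2 lambda + beta) lambda_x = - alpha_x - beta_x lambda and its analogue in y, split
    into parts, with a factor Im lambda cancelled from the imaginary ones. *)
Lemma lam_partials z : Om z ->
  [/\ 2 * dx la z = - dx be z, 2 * dy la z = - dy be z,
      2 * lb z * dx lb z = dx al z + dx be z * la z &
      2 * lb z * dy lb z = dy al z + dy be z * la z].
Proof.
move=> Oz; have [aC bC dC _ _] := elliptic_C1; have [_ _ d0] := ell.
have da := C1_differentiable oOm aC Oz; have db := C1_differentiable oOm bC Oz.
have dd := C1_differentiable oOm dC Oz.
have dk (k : R) : differentiable (fun=> k) z := differentiable_cst k z.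
have kx (k : R) : dx (fun=> k) z = 0 by exact: derive_cst.
have ky (k : R) : dy (fun=> k) z = 0 by exact: derive_cst.
have [nx ny] := partialsN db.
have [lx ly] := partialsM (differentiableN db) (dk 2^-1).
have [ax ay] := partialsM (dk 4) da.
have [bx bY] := partialsM db db.
have [bnx bny] := partialsN (differentiableM db db).
have [ddx ddy] := partialsD (differentiableM (dk 4) da)
  (differentiableN (differentiableM db db)).
have [ds sx sy] := partials_sqrt dd (d0 z Oz).
have [ix iy] := partialsM ds (dk 2^-1).
have s0 : Num.sqrt (discr al be z) != 0 by rewrite gt_eqF// sqrtr_gt0 d0.
have dxd : dx (discr al be) z = 4 * dx al z - 2 * be z * dx be z.
  by rewrite [LHS]ddx ax bnx bx kx; ring.
have dyd : dy (discr al be) z = 4 * dy al z - 2 * be z * dy be z.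
  by rewrite [LHS]ddy ay bny bY ky; ring.
have lax : dx la z = - dx be z / 2 by rewrite [LHS]lx nx kx; field => //.
have lay : dy la z = - dy be z / 2 by rewrite [LHS]ly ny ky; field => //.
have lbx : dx lb z = (2 * Num.sqrt (discr al be z))^-1 *
    (4 * dx al z - 2 * be z * dx be z) / 2.
  by rewrite [LHS]ix sx kx dxd; ring.
have lby : dy lb z = (2 * Num.sqrt (discr al be z))^-1 *
    (4 * dy al z - 2 * be z * dy be z) / 2.
  by rewrite [LHS]iy sy ky dyd; ring.
rewrite lax lay lbx lby /re_lam /im_lam.
by split; field => //.
Qed.

Lemma fiber_eval_2gen z : 0 < discr al be z ->
  fiber_eval (2 * gen al be z + (be z)%:A) = 0 +i* (2 * lb z).
Proof.
move=> dz; rewrite fiber_evalD mulr_natl mulr2n fiber_evalD fiber_eval_gen.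
rewrite fiber_evalZ fiber_eval1 lamE mulr1.
by apply/eqP; rewrite eq_complex/=; apply/andP; split; apply/eqP;
  rewrite /re_lam; field => //.
Qed.

(** The quotient is handled by multiplying with the image of the denominator, 2 lambda + beta = 2 i
    Im lambda, which is nonzero and can be cancelled in the complex numbers. *)
Lemma fiber_eval_solve z (a b : R) : 0 < discr al be z ->
  fiber_eval ((- a%:A - b *: gen al be z) / (2 * gen al be z + (be z)%:A)) =
    (- (b / 2)) +i* ((a + b * la z) / (2 * lb z)).
Proof.
move=> dz; have b0 := im_lam_gt0 dz.
have nz : 0 +i* (2 * lb z) != 0 :> R[i].
  by rewrite eq_complex/= eqxx/= gt_eqF// mulr_gt0.
apply: (mulIf nz); rewrite -{1}fiber_eval_2gen// fiber_eval_div//; last first.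
  exact: gen_unit.
rewrite fiber_evalD !fiber_evalN !fiber_evalZ fiber_eval1 fiber_eval_gen lamE.
apply/eqP; rewrite eq_complex/=; simpc => /=.
apply/andP; split; apply/eqP; field => //.
by rewrite gt_eqF.
Qed.

(** The image of i_x and the number lambda_x solve the same linear equation, whose coefficient 2
    lambda + beta is nonzero; likewise in y. *)
Lemma fiber_eval_gen_xy z : Om z ->
  fiber_eval (gen_x al be z) = dx la z +i* dx lb z /\
  fiber_eval (gen_y al be z) = dy la z +i* dy lb z.
Proof.
move=> Oz; have [_ _ d0] := ell; have b0 := im_lam_gt0 (d0 z Oz).
have b2 : 2 * lb z != 0 by rewrite gt_eqF// mulr_gt0.
have [e1 e2 e3 e4] := lam_partials Oz.
have t (u : R) : 2 * u / 2 = u by field => //.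
have tb u : 2 * lb z * u / (2 * lb z) = u by rewrite mulrAC divff ?mul1r.
split.
  rewrite [LHS](fiber_eval_solve (dx al z) (dx be z) (d0 z Oz)) -e3 tb.
  by rewrite -mulNr -e1 t.
rewrite [LHS](fiber_eval_solve (dy al z) (dy be z) (d0 z Oz)) -e4 tb.
by rewrite -mulNr -e2 t.
Qed.

(** Stated for arbitrary [a] and [b] because the shape a + i b occurs twice: in the obstruction i_x
    + i i_y and in W_x + i W_y. *)
Lemma fiber_eval_obstruction z (a b : fiber al be z) (x y : R[i]) :
  0 < discr al be z -> fiber_eval a = x -> fiber_eval b = y ->
  fiber_eval (a + gen al be z * b) = x + lam al be z * y.
Proof.
by move=> dz <- <-; rewrite fiber_evalD fiber_evalM// fiber_eval_gen.
Qed.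

Lemma fiber_eval_derivative z (u v w : R) (a : fiber al be z) (x : R[i]) :
  fiber_eval a = x ->
  fiber_eval (u%:A + v *: gen al be z + w *: a) =
    u%:C + v%:C * lam al be z + w%:C * x.
Proof.
move=> <-; rewrite !fiber_evalD !fiber_evalZ fiber_eval1 fiber_eval_gen.
by rewrite mulr1.
Qed.

(* lambda_x + lambda lambda_y = 0, in real form. *)
Lemma rigid_lam z : rigid al be Om -> Om z ->
  dx la z + la z * dy la z - lb z * dy lb z = 0 /\
  dx lb z + la z * dy lb z + lb z * dy la z = 0.
Proof.
move=> rig Oz; have [_ _ d0] := ell; have [ex ey] := fiber_eval_gen_xy Oz.
have := etrans (esym (fiber_eval_obstruction (d0 z Oz) ex ey))
  (congr1 (@fiber_eval _ _ _ z) (rig z Oz)).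
rewrite fiber_eval0 lamE => /eqP.
rewrite eq_complex/= => /andP[/eqP h1 /eqP h2].
by split; [rewrite -h1|rewrite -h2]; ring.
Qed.

Variable W : section al be.

Definition re_transport z : R := coU W z + coV W z * la z.
Definition im_transport z : R := coV W z * lb z.

Lemma transport_eval (S : section al be) z : transport S z = fiber_eval (S z).
Proof. by rewrite fiber_evalE. Qed.

Lemma transportE z : transport W z = re_transport z +i* im_transport z.
Proof.
rewrite /transport lamE; apply/eqP; rewrite eq_complex/=.
by apply/andP; split; apply/eqP; rewrite /re_transport /im_transport; ring.
Qed.

(** The term V i_x goes to V lambda_x, so by the product rule W_x goes to the x-derivative of f =
    W_lambda, and similarly in y. The right side is f_x + lambda f_y in real and imaginary parts;
    the factor 2 clears the half in [dzbar]. *)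
Lemma transport_dzbar z : Om z -> differentiable (coU W) z ->
  differentiable (coV W) z ->
  2 * transport (dzbar W) z =
  (dx re_transport z + la z * dy re_transport z - lb z * dy im_transport z) +i*
  (dx im_transport z + la z * dy im_transport z + lb z * dy re_transport z).
Proof.
move=> Oz dU dV; have [_ _ _ laC lbC] := elliptic_C1; have [_ _ d0] := ell.
have da := C1_differentiable oOm laC Oz.
have db := C1_differentiable oOm lbC Oz.
have [vax vay] := partialsM dV da; have [vbx vby] := partialsM dV db.
have [rx ry] := partialsD dU (differentiableM dV da).
have Rx : dx re_transport z =
    dx (coU W) z + (coV W z * dx la z + la z * dx (coV W) z).
  exact: etrans rx (congr1 (+%R _) vax).
have Ry : dy re_transport z =
    dy (coU W) z + (coV W z * dy la z + la z * dy (coV W) z).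
  exact: etrans ry (congr1 (+%R _) vay).
have Ix : dx im_transport z = coV W z * dx lb z + lb z * dx (coV W) z := vbx.
have Iy : dy im_transport z = coV W z * dy lb z + lb z * dy (coV W) z := vby.
have [ex ey] := fiber_eval_gen_xy Oz.
have sx : fiber_eval (sec_x W z) = _ :=
  fiber_eval_derivative (dx (coU W) z) (dx (coV W) z) (coV W z) ex.
have sy : fiber_eval (sec_y W z) = _ :=
  fiber_eval_derivative (dy (coU W) z) (dy (coV W) z) (coV W z) ey.
rewrite transport_eval.
have := fiber_eval_obstruction (d0 z Oz) sx sy.
rewrite /dzbar fiber_evalZ fmorphV/= rmorph_nat mulrA.
rewrite divff ?pnatr_eq0// mul1r => ->.
rewrite Rx Ry Ix Iy lamE.
apply/eqP; rewrite eq_complex/=; apply/andP; split; apply/eqP; ring.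
Qed.

(** The conjugate generator - beta - i goes to - beta - lambda, the other root of the structure
    polynomial, which is conj(lambda). *)
Lemma transport_conj z : transport (sec_conj W) z = (transport W z)^*.
Proof.
rewrite transportE transport_eval /sec_conj fiber_evalD !fiber_evalZ.
rewrite fiber_eval1 fiber_evalD !fiber_evalN fiber_evalZ fiber_eval1
  fiber_eval_gen lamE.
apply/eqP; rewrite eq_complex/=; apply/andP; split; apply/eqP;
  rewrite /re_transport /im_transport /re_lam; field => //.
Qed.

End Spectral.

(** * The coordinate xi *)

Section Coordinate.
Context {R : realType}.
Variables (al be : R * R -> R) (Om : set (R * R)).
Hypotheses (oOm : open Om) (ell : elliptic_structure al be Om)
  (rig : rigid al be Om).
Implicit Types (z : R * R).

Notation la := (re_lam be).
Notation lb := (im_lam al be).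
Notation phi := (pq (xi al be)).
Notation p := (fun w => (phi w).1).
Notation q := (fun w => (phi w).2).

Lemma pq_xiE :
  p = (fun w => w.2 + - (la w * w.1)) /\ q = (fun w => - (lb w * w.1)).
Proof.
by split; apply/funext => w; rewrite /pq /xi lamE /=; ring.
Qed.

Lemma pq_xi_C1 : C1_map Om phi.
Proof.
have [_ _ _ laC lbC] := elliptic_C1 oOm ell; have [pE qE] := pq_xiE.
split; rewrite ?pE ?qE.
  exact: C1_add oOm (C1_snd oOm) (C1_opp oOm (C1_mul oOm laC (C1_fst oOm))).
exact: C1_opp oOm (C1_mul oOm lbC (C1_fst oOm)).
Qed.

(* xi_x + lambda xi_y = 0, in real form. *)
Lemma pq_xi_char z : Om z ->
  dx p z = - la z * dy p z + lb z * dy q z /\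
  dx q z = - la z * dy q z - lb z * dy p z.
Proof.
move=> Oz; have [_ _ _ laC lbC] := elliptic_C1 oOm ell.
have da := C1_differentiable oOm laC Oz.
have db := C1_differentiable oOm lbC Oz.
have d1 := C1_differentiable oOm (C1_fst oOm) Oz.
have d2 := C1_differentiable oOm (C1_snd oOm) Oz.
have [f1 f2] := fst_partials z; have [s1 s2] := snd_partials z.
have [ax ay] := partialsM da d1; have [bx bY] := partialsM db d1.
have [anx any] := partialsN (differentiableM da d1).
have [bnx bny] := partialsN (differentiableM db d1).
have [px py] := partialsD d2 (differentiableN (differentiableM da d1)).
have [pE qE] := pq_xiE; rewrite pE qE.
have [h1 h2] := rigid_lam oOm ell rig Oz.
have -> : dx (fun w => w.2 + - (la w * w.1)) z = - (la z + z.1 * dx la z).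
  apply: etrans px _; rewrite s1 add0r; apply: etrans anx _; congr (- _).
  by apply: etrans ax _; congr (_ + _); rewrite f1 mulr1.
have -> : dy (fun w => w.2 + - (la w * w.1)) z = 1 - z.1 * dy la z.
  apply: etrans py _; rewrite s2; congr (_ + _); apply: etrans any _.
  by congr (- _); apply: etrans ay _; rewrite f2 mulr0 add0r.
have -> : dx (fun w => - (lb w * w.1)) z = - (lb z + z.1 * dx lb z).
  apply: etrans bnx _; congr (- _).
  by apply: etrans bx _; congr (_ + _); rewrite f1 mulr1.
have -> : dy (fun w => - (lb w * w.1)) z = - (z.1 * dy lb z).
  apply: etrans bny _; congr (- _).
  by apply: etrans bY _; rewrite f2 mulr0 add0r.
(* The undifferentiated lambda terms cancel: xi_x + lambda xi_y = - x (lambda_x + lambda lambda_y),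
   which rigidity annihilates. *)
split; apply/eqP; rewrite -subr_eq0; apply/eqP.
  transitivity (- z.1 * (dx la z + la z * dy la z - lb z * dy lb z)).
    by ring.
  by rewrite h1 mulr0.
transitivity (- z.1 * (dx lb z + la z * dy lb z + lb z * dy la z)).
  by ring.
by rewrite h2 mulr0.
Qed.

(** Conjugating xi_x = - lambda xi_y gives Phi = (lambda - conj lambda) conj(xi_y) = 2 i b (p_y - i
    q_y) with b = Im lambda. *)
Lemma Phi_xi z : Om z ->
  Phi al be z = (2 * lb z * dy q z) +i* (2 * lb z * dy p z).
Proof.
move=> Oz; have [_ qC] := pq_xi_C1.
have dq := C1_differentiable oOm qC Oz.
have [nx ny] := partialsN dq; have [ex ey] := pq_xi_char Oz.
have E1 : (fun w => complex.Re ((xi al be w)^*)) = p.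
  by apply/funext => w; rewrite /pq; case: (xi al be w).
have E2 : (fun w => complex.Im ((xi al be w)^*)) = (fun w => - q w).
  by apply/funext => w; rewrite /pq; case: (xi al be w).
rewrite /Phi /dxC /dyC E1 E2 nx ny ex ey lamE.
by apply/eqP; rewrite eq_complex/=; apply/andP; split; apply/eqP; ring.
Qed.

Lemma jacdet_xi z : Om z ->
  jacdet phi z = lb z * (dy p z ^+ 2 + dy q z ^+ 2).
Proof.
by move=> Oz; have [ex ey] := pq_xi_char Oz; rewrite /jacdet ex ey; ring.
Qed.

Lemma jacdet_xi_neq0 z : Om z -> Phi al be z != 0 -> jacdet phi z != 0.
Proof.
move=> Oz; have [_ _ d0] := ell; have b0 := im_lam_gt0 (d0 z Oz).
rewrite (Phi_xi Oz) (jacdet_xi Oz); apply: contra.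
rewrite mulf_eq0 (gt_eqF b0)/= paddr_eq0 ?sqr_ge0// !sqrf_eq0.
by move=> /andP[/eqP -> /eqP ->]; rewrite eq_complex/= !mulr0 eqxx.
Qed.

(** Here r + i s stands for f and a + i b for lambda. The bracket is the dbar-derivative of f
    composed with the inverse, p_x and q_x being already eliminated by the characteristic equations;
    the second factor is Phi. *)
Lemma dbar_algebra (rx ry sx sy py qy a b J : R) :
  J = b * (py ^+ 2 + qy ^+ 2) -> J != 0 ->
  (((rx * (qy / J) + ry * - ((- a * qy - b * py) / J)) +i*
    (sx * (qy / J) + sy * - ((- a * qy - b * py) / J)) +
   'i%C * ((rx * - (py / J) + ry * ((- a * py + b * qy) / J)) +i*
           (sx * - (py / J) + sy * ((- a * py + b * qy) / J)))) / 2) *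
  ((2 * b * qy) +i* (2 * b * py)) =
  (rx + a * ry - b * sy) +i* (sx + a * sy + b * ry).
Proof.
move=> JE J0; rewrite invC2.
apply/eqP; rewrite eq_complex/=; apply/andP; split; apply/eqP.
  (* With [J] treated as a free variable, the two sides differ exactly by the factor b (py^2 + qy^2)
     / J, which [JE] makes equal to 1. *)
  transitivity ((b * (py ^+ 2 + qy ^+ 2) / J) * (rx + a * ry - b * sy)).
    by field.
  by rewrite -JE divff// mul1r.
transitivity ((b * (py ^+ 2 + qy ^+ 2) / J) * (sx + a * sy + b * ry)).
  by field.
by rewrite -JE divff// mul1r.
Qed.

Lemma dbar_comp (U : set (R * R)) (g : R * R -> R * R) (f : R * R -> R[i]) z :
  open U -> U `<=` Om -> (forall w, U w -> Phi al be w != 0) ->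
  (forall w, U w -> g (phi w) = w) -> U z ->
  differentiable (fun w => complex.Re (f w)) z ->
  differentiable (fun w => complex.Im (f w)) z ->
  has_partialsC (f \o g) (phi z) /\
  dbar (f \o g) (phi z) * Phi al be z =
  (dx (fun w => complex.Re (f w)) z + la z * dy (fun w => complex.Re (f w)) z
   - lb z * dy (fun w => complex.Im (f w)) z) +i*
  (dx (fun w => complex.Im (f w)) z + la z * dy (fun w => complex.Im (f w)) z
   + lb z * dy (fun w => complex.Re (f w)) z).
Proof.
move=> oU UO Phi0 gK Uz.
set fr := (fun w => _ (f w)); set fi := (fun w => _ (f w)).
have gz := gK z Uz; move=> dr di.
have UC : C1_map U phi.
  by have [pC qC] := pq_xi_C1; split=> w /UO; [exact: pC|exact: qC].
have J0 w : U w -> jacdet phi w != 0.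
  by move=> Uw; apply: jacdet_xi_neq0; [exact: UO|exact: Phi0].
have [d1 d2 [e1 e2] [e3 e4]] := left_inverse_partials oU UC J0 gK Uz.
have dr' : differentiable fr (g (phi z)) by rewrite gz.
have di' : differentiable fi (g (phi z)) by rewrite gz.
have [cr crx cry] := comp_partials dr' d1 d2.
have [ci cix ciy] := comp_partials di' d1 d2.
split.
  split; [exact: diff_derivable cr|exact: diff_derivable cr|
    exact: diff_derivable ci|exact: diff_derivable ci].
rewrite gz e1 e3 in crx; rewrite gz e2 e4 in cry.
rewrite gz e1 e3 in cix; rewrite gz e2 e4 in ciy.
have [ex ey] := pq_xi_char (UO _ Uz).
have Jz := J0 z Uz; have JE := jacdet_xi (UO _ Uz).
have HX : dxC (f \o g) (phi z) = _ +i* _ := congr2 (@Complex R) crx cix.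
have HY : dyC (f \o g) (phi z) = _ +i* _ := congr2 (@Complex R) cry ciy.
rewrite /dbar HX HY (Phi_xi (UO _ Uz)).
rewrite ex ey.
exact: dbar_algebra.
Qed.

End Coordinate.

Theorem theorem6p1 (R : realType) (Om : set (R * R)) (al be : R * R -> R)
    (A B F : section al be) (Om' : set (R * R)) (W : section al be) :
  open Om -> elliptic_structure al be Om -> rigid al be Om ->
  open Om' -> connected Om' -> Om' `<=` Om ->
  (forall z, Om' z -> Phi al be z != 0) ->
  C1_section Om' W ->
  (forall z, Om' z -> dzbar W z + A z * W z + B z * sec_conj W z = F z) ->
  let xi := xi al be in
  let f := transport W in
  let A' := fun z => 2 * transport A z / Phi al be z in
  let B' := fun z => 2 * transport B z / Phi al be z in
  let F' := fun z => 2 * transport F z / Phi al be z in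
  vekua_coord xi Om' A' B' F' f /\
  ({in Om' &, injective xi} ->
     [/\ open (pq xi @` Om'), connected (pq xi @` Om') &
         forall g : R * R -> R * R, (forall z, Om' z -> g (pq xi z) = z) ->
           vekua_on (pq xi @` Om') (A' \o g) (B' \o g) (F' \o g) (f \o g)]).
Proof.
move=> oOm ell rig oD _cD sD Phi0 [UC VC] vek xi0 f A' B' F'.
have [_ _ _ laC lbC] := elliptic_C1 oOm ell; have [_ _ d0] := ell.
have restrict h : C1_on Om h -> C1_on Om' h by move=> hC z /sD; exact: hC.
pose fr w := complex.Re (f w); pose fi w := complex.Im (f w).
have frC : C1_on Om' fr.
  rewrite (_ : fr = re_transport W); last first.
    by apply/funext => w; rewrite /fr /f transportE.
  exact: C1_add oD UC (C1_mul oD VC (restrict _ laC)).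
have fiC : C1_on Om' fi.
  rewrite (_ : fi = im_transport W); last first.
    by apply/funext => w; rewrite /fi /f transportE.
  exact: C1_mul oD VC (restrict _ lbC).
have [pC qC] := pq_xi_C1 oOm ell.
have phiC : C1_map Om' (pq xi0) := conj (restrict _ pC) (restrict _ qC).
have J0 z : Om' z -> jacdet (pq xi0) z != 0.
  by move=> Dz; apply: (jacdet_xi_neq0 oOm ell rig); [exact: sD|exact: Phi0].
(* The candidate for f_{conj xi}: f_x + lambda f_y is 2 (dzbar W)_lambda and also Phi times that
   derivative. With this [v], the transported equation is the Vekua equation evaluated at lambda,
   times 2 / Phi. *)
pose v z := 2 * transport (dzbar W) z / Phi al be z.
have vE z : Om' z -> v z + A' z * f z + B' z * (f z)^* = F' z.
  move=> Dz; have dz := d0 z (sD z Dz).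
  have := congr1 (@fiber_eval _ _ _ z) (vek z Dz).
  rewrite 2!fiber_evalD 2!(fiber_evalM dz) -!transport_eval transport_conj => E.
  by rewrite /v /A' /B' /F' -E /f; ring.
have key U g z : open U -> U `<=` Om' -> (forall w, U w -> g (pq xi0 w) = w) ->
    U z -> has_partialsC (f \o g) (pq xi0 z) /\ dbar (f \o g) (pq xi0 z) = v z.
  move=> oU UD gK Uz; have Dz := UD z Uz.
  have [hp E] := dbar_comp oOm ell rig oU (subset_trans UD sD)
    (fun w Uw => Phi0 w (UD w Uw)) gK Uz (C1_differentiable oD frC Dz)
    (C1_differentiable oD fiC Dz).
  split; first exact: hp.
  apply: (mulIf (Phi0 z Dz)); rewrite E /v divfK ?Phi0//.
  rewrite (transport_dzbar oOm ell (sD z Dz) (C1_differentiable oD UC Dz)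
    (C1_differentiable oD VC Dz)).
  have -> : (fun w => complex.Re (f w)) = re_transport W.
    by apply/funext => w; rewrite /f transportE.
  have -> // : (fun w => complex.Im (f w)) = im_transport W.
  by apply/funext => w; rewrite /f transportE.
split.
  move=> z Dz; exists (v z); last exact: vE.
  split; first exact: local_diffeo oD phiC J0 Dz.
  move=> U g Uz [[oU _] _ gK _].
  (* The domain of an arbitrary local diffeomorphism may leave [Om'], where neither W nor Phi is
     controlled, so it is first cut down to its intersection with [Om']. *)
  apply: (key _ g z (openI oU oD) (@subIsetr _ U Om') _ (conj Uz Dz)).
  by move=> w [/gK].
move=> _; have oV := open_image oD phiC J0; split; first exact: oV.
  apply: connected_continuous_connected => //; apply: continuous_in_subspaceT.
  by move=> z /set_mem Dz; exact: C1_map_continuous oD phiC Dz.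
move=> g gK; have gC := left_inverse_C1 oD phiC J0 gK.
have gD w : (pq xi0 @` Om') w -> Om' (g w) by move=> [z Dz <-]; rewrite gK.
split.
  by split; [exact: C1_comp oD oV frC gC gD|exact: C1_comp oD oV fiC gC gD].
move=> _ [z Dz <-]; have [_ ->] := key Om' g z oD (@subset_refl _ Om') gK Dz.
by rewrite /= gK//; exact: vE.
Qed.
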